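(* Let $q\in\mathbb{C}$ with $0<|q|<1$, let $r\in\mathbb{N}$ (that is, $r\ge 1$), let $x\in\mathbb{R}$, let $n\ge 0$ be an integer, and let $a,b\in\mathbb{N}$ with $a\equiv 1\pmod 2$ and $b\equiv 1\pmod 2$. Then \begin{align*} & [2]_{q^{b}}^{r}\,[a]_{q}^{n}\sum_{j_{1},\ldots,j_{r}=0}^{a-1}(-1)^{\sum_{l=1}^{r}j_{l}}\,q^{b\sum_{l=1}^{r}j_{l}}\,E_{n,q^{a}}^{(r)}\left(bx+\frac{b}{a}(j_{1}+\cdots+j_{r})\right)\\ ={} & [2]_{q^{a}}^{r}\,[b]_{q}^{n}\sum_{j_{1},\ldots,j_{r}=0}^{b-1}(-1)^{\sum_{l=1}^{r}j_{l}}\,q^{a\sum_{l=1}^{r}j_{l}}\,E_{n,q^{b}}^{(r)}\left(ax+\frac{a}{b}(j_{1}+\cdots+j_{r})\right). \end{align*}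
   Context: Powers of $q$: fix a logarithm $\log q$ of $q$ and put $q^{y}=\exp(y\log q)$ for $y\in\mathbb{R}$; for $c\in\mathbb{N}$, real powers of $q^{c}$ are understood as $(q^{c})^{y}=q^{cy}$. $q$-numbers: for $c\in\mathbb{N}$ and $y\in\mathbb{R}$, $[y]_{q^{c}}=\frac{1-q^{cy}}{1-q^{c}}$; in particular $[y]_q=\frac{1-q^{y}}{1-q}$ and $[2]_{q^c}=1+q^c$. Higher-order $q$-Euler polynomials: for $c\in\mathbb{N}$ and $y\in\mathbb{R}$, the quantities $E_{n,q^{c}}^{(r)}(y)$, $n\ge 0$, are defined by the generating function $$[2]_{q^{c}}^{r}\sum_{m_{1},\ldots,m_{r}=0}^{\infty}(-q^{c})^{m_{1}+\cdots+m_{r}}\,e^{[m_{1}+\cdots+m_{r}+y]_{q^{c}}\,t}=\sum_{n=0}^{\infty}E_{n,q^{c}}^{(r)}(y)\frac{t^{n}}{n!},$$ where $(-q^c)^{m}=(-1)^m q^{cm}$. *)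

(* Defs.v *)
(* MathComp-Analysis; the complex numbers are R[i] for R : realType. *)
From mathcomp Require Import all_boot all_order all_algebra finmap.
From mathcomp Require Import all_classical all_reals all_analysis.
From mathcomp Require Import complex.
From mathcomp Require Import analysis.showcase.summability.

Set Implicit Arguments.
Unset Strict Implicit.
Unset Printing Implicit Defensive.

Import Order.TTheory GRing.Theory Num.Theory.
Import numFieldNormedType.Exports.

Local Open Scope classical_set_scope.
Local Open Scope ring_scope.
Local Open Scope complex_scope.

(* e^(u + iv) = e^u (cos v + i sin v) *)
Definition cexp (R : realType) (z : R[i]) : R[i] :=
  let: u +i* v := z in (expR u * cos v) +i* (expR u * sin v).

(* Below, L is the chosen logarithm of q, so q itself is cexp L, and the real
   powers of q are qpow L y = q^y := exp (y log q). *)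
Definition qpow (R : realType) (L : R[i]) (y : R) : R[i] := cexp (y%:C * L).

(* [y]_{q^c}, with (q^c)^y read as q^(c y) *)
Definition qnum (R : realType) (L : R[i]) (c : nat) (y : R) : R[i] :=
  (1 - qpow L (c%:R * y)) / (1 - cexp L ^+ c).

(* The (m_1, ..., m_r) term of the multiple series. The alias R[i]^o only
   selects the normed topology of R[i]. *)
Definition qEuler_term (R : realType) (L : R[i]) (c r : nat) (y : R) (t : R[i])
    (m : {ffun 'I_r -> nat}) : R[i]^o :=
  let s := (\sum_(l < r) m l)%N in
  (-1) ^+ s * cexp L ^+ (c * s) * cexp (qnum L c (s%:R + y) * t).

(* E is the coefficient sequence of the generating function: for every complex
   t, the multiple series sums unconditionally (along the finite subsets of
   N^r) to some S, and sum_n E_n t^n / n! converges to [2]_{q^c}^r S. *)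
Definition is_qEuler (R : realType) (L : R[i]) (c r : nat) (y : R)
    (E : nat -> R[i]) : Prop :=
  forall t : R[i], exists2 S : R[i]^o,
    partial_sum (@qEuler_term R L c r y t) @ totally --> S &
    series (fun n => E n * t ^+ n / n`!%:R : R[i]^o) @ \oo -->
      (qnum L c 2 ^+ r * S : R[i]^o).

(* E_{n,q^c}^{(r)}(y). The generating function converges and determines its
   coefficients when 0 < |q| < 1 and c >= 1; otherwise the value may be junk. *)
Definition qEuler (R : realType) (L : R[i]) (c r n : nat) (y : R) : R[i] :=
  xget (fun=> 0) [set E | is_qEuler L c r y E] n.

(* Main.v *)
Require Import Defs.
From mathcomp Require Import all_boot all_order all_algebra finmap.
From mathcomp Require Import all_classical all_reals all_analysis.
From mathcomp Require Import complex.
From mathcomp Require Import analysis.showcase.summability.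
From mathcomp Require Import ring lra.

Set Implicit Arguments.
Unset Strict Implicit.
Unset Printing Implicit Defensive.

Import Order.TTheory GRing.Theory Num.Theory.
Import numFieldNormedType.Exports.

Local Open Scope classical_set_scope.
Local Open Scope ring_scope.
Local Open Scope complex_scope.

(** The generating function determines the [q]-Euler polynomials, and expanding
it gives them in closed form.  With [Q = q ^ c] and [w = q ^ (c y)] one has
[[s + y]_Q = (1 - w Q ^ s) / (1 - Q)].  Expanding the exponential, then
[[s + y]_Q ^ n] by the binomial theorem, and summing over [m_1, ..., m_r] the
product of [r] geometric series of ratio [- Q ^ (k + 1)] gives

  E_n = (1 + Q) ^ r (1 - Q) ^ - n
          sum_k C(n, k) (- w) ^ k / (1 + Q ^ (k + 1)) ^ r.

Once this is known (lemma [qEulerE]) the symmetry is finite algebra.  On the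
left-hand side [w] is [q ^ (a b x)] times [q ^ (b (j_1 + ... + j_r))], so the
sum over the [j_l] is, for each [k], the [r]-th power of
[sum_(i < a) (- q ^ (b (k + 1))) ^ i], that is, as [a] is odd, of
[(1 + q ^ (a b (k + 1))) / (1 + q ^ (b (k + 1)))].  The factor [[a]_q ^ n] turns
[(1 - q ^ a) ^ - n] into [(1 - q) ^ - n], and what remains is symmetric in [a]
and [b] (lemma [qEuler_coef_sum]).

The analytic work is to show that the closed form satisfies the defining
property and is the only sequence to do so.

- The exponential is defined by its real and imaginary parts; the remainder
  bound [norm_cexp_taylor] identifies it with its power series, uniformly on
  discs.
- In the multiple series the exponential is replaced by its Taylor polynomial
  of degree less than [K].  The error is uniform over the finite sets of
  indices and vanishes as [K] grows, so that the two limits may be exchanged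
  ([cvgC_interchange]); for fixed [K] the sum is a finite combination of
  multiple geometric series ([cvgC_multi_geometric]).
- A power series that converges to [0] everywhere has zero coefficients
  ([power_series_eq0]). *)

(** * The complex exponential and its power series *)

Lemma cexp0 (R : realType) : cexp (0 : R[i]) = 1.
Proof. by rewrite /cexp /= expR0 cos0 sin0 mulr1 mulr0. Qed.

Lemma cexpD (R : realType) (z w : R[i]) : cexp (z + w) = cexp z * cexp w.
Proof.
case: z w => [u v] [u' v']; rewrite /cexp /= expRD cosD sinD.
by apply/eqP; rewrite eq_complex /=; apply/andP; split; apply/eqP; ring.
Qed.

Lemma cexpMn (R : realType) (z : R[i]) n : cexp (n%:R * z) = cexp z ^+ n.
Proof.
by elim: n => [|n IH]; rewrite ?mul0r ?cexp0// -natr1 mulrDl mul1r cexpD IH exprSr.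
Qed.

(** [g + f] and [g - f] vanish at [0] and are nondecreasing on [[0, 1]]. *)
Lemma norm_le_of_derive (R : realType) (f g df dg : R -> R) :
  (forall s : R, is_derive s 1 f (df s)) -> (forall s : R, is_derive s 1 g (dg s)) ->
  f 0 = 0 -> g 0 = 0 ->
  (forall s, 0 <= s <= 1 -> `|df s| <= dg s) ->
  forall s, 0 <= s <= 1 -> `|f s| <= g s.
Proof.
move=> hf hg f0 g0 le s /andP[s0 s1].
have key (h dh : R -> R) : (forall s : R, is_derive s 1 h (dh s)) -> h 0 = 0 ->
    (forall s, 0 <= s <= 1 -> 0 <= dh s) -> 0 <= h s.
  move=> hh h0 h_ge; rewrite -h0.
  have dh' x : derivable h x 1 by have := hh x.
  apply: (@ger0_derive1_ndecr R h 0 1) => // [x xI|].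
    rewrite derive1E derive_val; apply: h_ge.
    by move: xI; rewrite in_itv/= => /andP[/ltW -> /ltW ->].
  by apply: derivable_within_continuous => x _.
rewrite ler_norml; apply/andP; split.
- rewrite -subr_ge0 opprK.
  apply: (key (f + g) (fun s => df s + dg s)) => [|x xI].
  + by change (f 0 + g 0 = 0); rewrite f0 g0 addr0.
  + by have := le x xI; rewrite ler_norml => /andP[? _]; lra.
- rewrite -subr_ge0.
  apply: (key (g - f) (fun s => dg s - df s)) => [|x xI].
  + by change (g 0 - f 0 = 0); rewrite f0 g0 subr0.
  + by have := le x xI; rewrite ler_norml => /andP[_ ?]; lra.
Qed.

(** Taylor's formula for [s |-> cexp (s z)] on [[0, 1]], by induction on the
order: the derivative of the remainder of order [N + 1] is [z] times the
remainder of order [N].  On real and imaginary parts, multiplication by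
[z = u + i v] costs a factor [`|u| + `|v|], and integrating [s ^ N / N!] gives
[s ^ (N + 1) / (N + 1)!]. *)
Lemma cexp_taylor_parts (R : realType) (z : R[i]) (N : nat) (s : R) :
  0 <= s <= 1 ->
  let u := complex.Re z in let v := complex.Im z in
  let b := expR `|u| * ((`|u| + `|v|) ^+ N / N`!%:R * s ^+ N) in
  `|expR (s * u) * cos (s * v) -
     (\poly_(n < N) (complex.Re (z ^+ n) / n`!%:R)).[s]| <= b /\
  `|expR (s * u) * sin (s * v) -
     (\poly_(n < N) (complex.Im (z ^+ n) / n`!%:R)).[s]| <= b.
Proof.
move=> sI u v; elim: N s sI => [|N IH] s sI /=.
  rewrite !poly_def !big_ord0 !horner0 !subr0 !expr0 fact0 divr1 !mulr1.
  have [s0 s1] := andP sI.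
  have le_e : expR (s * u) <= expR `|u|.
    rewrite ler_expR; apply: le_trans (ler_norm _) _.
    by rewrite normrM (ger0_norm s0) ler_piMl.
  rewrite !normrM !(ger0_norm (expR_ge0 _)).
  split; apply: le_trans le_e; rewrite ler_piMr ?expR_ge0// ler_norml.
    by rewrite cos_geN1 cos_le1.
  by rewrite sin_geN1 sin_le1.
set K := `|u| + `|v|; set M := expR `|u|.
pose p N := \poly_(n < N) (complex.Re (z ^+ n) / n`!%:R).
pose q N := \poly_(n < N) (complex.Im (z ^+ n) / n`!%:R).
have fS n : n.+1%:R / n.+1`!%:R = (n`!%:R)^-1 :> R.
  by rewrite factS natrM invfM mulrA divff ?pnatr_eq0// mul1r.
have cS (a : R) i : a / i.+1`!%:R *+ i.+1 = a / i`!%:R.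
  by rewrite -mulrnAr -[_^-1 *+ _]mulr_natl fS.
have reM (x y : R[i]) : complex.Re (x * y) =
    complex.Re x * complex.Re y - complex.Im x * complex.Im y.
  by case: x y => [? ?] [? ?].
have imM (x y : R[i]) : complex.Im (x * y) =
    complex.Re x * complex.Im y + complex.Im x * complex.Re y.
  by case: x y => [? ?] [? ?].
have dp : (p N.+1)^`() = u *: p N - v *: q N.
  apply/polyP => i; rewrite coef_deriv coefB !coefZ !coef_poly ltnS.
  case: ifP => _; last by rewrite mul0rn !mulr0 subr0.
  rewrite cS exprS ?reM ?imM; ring.
have dq : (q N.+1)^`() = u *: q N + v *: p N.
  apply/polyP => i; rewrite coef_deriv coefD !coefZ !coef_poly ltnS.
  case: ifP => _; last by rewrite mul0rn !mulr0 addr0.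
  rewrite cS exprS ?reM ?imM; ring.
pose g (s : R) := M * (K ^+ N.+1 / N.+1`!%:R * s ^+ N.+1).
pose dg (s : R) := K * (M * (K ^+ N / N`!%:R * s ^+ N)).
have Dg (t : R) : is_derive t 1 g (dg t).
  have -> : g = (M * (K ^+ N.+1 / N.+1`!%:R)) \*: (@id R ^+ N.+1).
    by apply/funext => y; rewrite /g /= fctE mulrA.
  apply: is_derive_eq; rewrite /dg -(fS N) exprS /GRing.scale /= mulr1.
  by ring.
have g0 : g 0 = 0 by rewrite /g expr0n /= !mulr0.
have De (t : R) : is_derive t 1 (fun s => expR (s * u)) (u * expR (t * u)).
  have -> : (fun s => expR (s * u)) = expR \o (u \*: id).
    by apply/funext => y /=; rewrite mulrC.
  apply: is_derive_eq.
  rewrite [u%:A]mulr1 -[(u \*: id) t]/(u * t) [u * t]mulrC; exact: mulrC.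
have Dc (t : R) : is_derive t 1 (fun s => cos (s * v)) (- v * sin (t * v)).
  have -> : (fun s => cos (s * v)) = @cos R \o (v \*: id).
    by apply/funext => y /=; rewrite mulrC.
  apply: is_derive_eq.
  by rewrite [v%:A]mulr1 -[(v \*: id) t]/(v * t) [v * t]mulrC; ring.
have Ds (t : R) : is_derive t 1 (fun s => sin (s * v)) (v * cos (t * v)).
  have -> : (fun s => sin (s * v)) = @sin R \o (v \*: id).
    by apply/funext => y /=; rewrite mulrC.
  apply: is_derive_eq.
  by rewrite [v%:A]mulr1 -[(v \*: id) t]/(v * t) [v * t]mulrC; ring.
have p0 : (p N.+1).[0] = 1.
  by rewrite horner_coef0 coef_poly /= divr1.
have q0 : (q N.+1).[0] = 0.
  by rewrite horner_coef0 coef_poly /= mul0r.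
have le_dg (x y A B : R) t : `|x| = `|u| /\ `|y| = `|v| \/ `|x| = `|v| /\ `|y| = `|u| ->
    `|A| <= M * (K ^+ N / N`!%:R * t ^+ N) ->
    `|B| <= M * (K ^+ N / N`!%:R * t ^+ N) -> `|x * A + y * B| <= dg t.
  move=> xy hA hB; apply: le_trans (ler_normD _ _) _; rewrite !normrM.
  have -> : dg t = `|x| * (M * (K ^+ N / N`!%:R * t ^+ N)) +
                   `|y| * (M * (K ^+ N / N`!%:R * t ^+ N)).
    by rewrite -mulrDl /dg /K; case: xy => [[-> ->]|[-> ->]] //; rewrite addrC.
  by apply: lerD; apply: ler_wpM2l.
split.
- apply: (@norm_le_of_derive _
    ((fun s => expR (s * u)) * (fun s => cos (s * v)) - horner (p N.+1)) g
    (fun s => u * (expR (s * u) * cos (s * v) - (p N).[s])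
            + - v * (expR (s * u) * sin (s * v) - (q N).[s])) dg) => //.
  + move=> t; apply: is_derive_eq.
    by rewrite dp hornerD hornerN !hornerZ /GRing.scale /=; ring.
  + change (expR (0 * u) * cos (0 * v) - (p N.+1).[0] = 0).
    by rewrite !mul0r expR0 cos0 p0 mulr1 subrr.
  + move=> t tI; have [h1 h2] := IH t tI.
    by apply: le_dg => //; left; rewrite normrN.
- apply: (@norm_le_of_derive _
    ((fun s => expR (s * u)) * (fun s => sin (s * v)) - horner (q N.+1)) g
    (fun s => v * (expR (s * u) * cos (s * v) - (p N).[s])
            + u * (expR (s * u) * sin (s * v) - (q N).[s])) dg) => //.
  + move=> t; apply: is_derive_eq.
    by rewrite dq hornerD !hornerZ /GRing.scale /=; ring.
  + change (expR (0 * u) * sin (0 * v) - (q N.+1).[0] = 0).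
    by rewrite !mul0r sin0 q0 mulr0 subrr.
  + move=> t tI; have [h1 h2] := IH t tI.
    by apply: le_dg => //; right.
Qed.

Lemma normc_le_ReIm (R : realType) (z : R[i]) :
  `|z| <= (`|complex.Re z| + `|complex.Im z|)%:C.
Proof.
rewrite normc_def lecR -[leRHS]ger0_norm ?addr_ge0// -sqrtr_sqr ler_sqrt ?sqr_ge0//.
rewrite sqrrD !real_normK ?num_real// lerD2r lerDl mulrn_wge0//.
Qed.

Lemma normc_ge_Im (R : realType) (z : R[i]) : `|complex.Im z|%:C <= `|z|.
Proof.
by rewrite normc_def lecR -sqrtr_sqr ler_wsqrtr// lerDr sqr_ge0.
Qed.

(** The bound depends on [z] only through a bound of its norm: this uniformity is
what allows the exchange of limits in [qexp_series]. *)
Lemma norm_cexp_taylor (R : realType) (z : R[i]) (rho : R) (N : nat) :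
  `|z| <= rho%:C ->
  `|cexp z - \sum_(n < N) z ^+ n / n`!%:R| <=
    (2 * expR rho * ((2 * rho) ^+ N / N`!%:R))%:C.
Proof.
move=> zr.
have ru : `|complex.Re z| <= rho by rewrite -lecR; exact: le_trans (normc_ge_Re z) zr.
have rv : `|complex.Im z| <= rho by rewrite -lecR; exact: le_trans (normc_ge_Im z) zr.
have [] := @cexp_taylor_parts R z N 1 _; first by rewrite ler01 lexx.
rewrite !mul1r expr1n mulr1 !horner_poly => hR hI.
have part (f : {additive Rcomplex R -> R}) :
    (forall (w : R[i]) (a : R), f (w * a%:C) = f w * a) ->
    f (\sum_(n < N) z ^+ n / n`!%:R) = \sum_(i < N) f (z ^+ i) / i`!%:R * 1 ^+ i.
  move=> fZ; rewrite raddf_sum; apply: eq_bigr => i _.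
  rewrite expr1n mulr1 -fZ; congr (f (_ * _)).
  by rewrite fmorphV rmorph_nat.
have sRe : complex.Re (cexp z - \sum_(n < N) z ^+ n / n`!%:R) =
    expR (complex.Re z) * cos (complex.Im z) -
    \sum_(i < N) complex.Re (z ^+ i) / i`!%:R * 1 ^+ i.
  rewrite raddfB; congr (_ - _); first by case: (z).
  by apply: part => -[w1 w2] a /=; rewrite mulr0 subr0.
have sIm : complex.Im (cexp z - \sum_(n < N) z ^+ n / n`!%:R) =
    expR (complex.Re z) * sin (complex.Im z) -
    \sum_(i < N) complex.Im (z ^+ i) / i`!%:R * 1 ^+ i.
  rewrite raddfB; congr (_ - _); first by case: (z).
  by apply: part => -[w1 w2] a /=; rewrite mulr0 add0r.
apply: le_trans (normc_le_ReIm _) _; rewrite lecR sRe sIm.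
apply: le_trans (lerD hR hI) _.
set b := expR _ * _.
suff hb : b <= expR rho * ((2 * rho) ^+ N / N`!%:R).
  by apply: le_trans (lerD hb hb) _; rewrite -[leRHS]mulrA [leRHS]mulr_natl mulr2n.
apply: ler_pM; rewrite ?ler_expR//.
rewrite ler_wpM2r ?invr_ge0// lerXn2r// ?nnegrE ?addr_ge0//.
  by rewrite mulr_ge0// (le_trans _ ru).
by rewrite mulr_natl mulr2n lerD.
Qed.

(** * Limits and power series over the complex numbers *)

(** [R[i]] gets its topology through the alias [R[i]^o], whose ring operations
are only convertible to those of [R[i]], at a prohibitive cost for unification.
The limit and the partial sums below keep every operation in [R[i]]. *)
Definition cvgC (R : realType) T (F : set_system T) (f : T -> R[i]) (l : R[i]) :=
  (f : T -> R[i]^o) @ F --> (l : R[i]^o).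

Definition seriesC (R : realType) (u : nat -> R[i]) (N : nat) : R[i] :=
  \sum_(0 <= n < N) u n.

Lemma cvgCP (R : realType) T (F : set_system T) (FF : Filter F)
    (f : T -> R[i]) (l : R[i]) :
  cvgC F f l <->
  forall e : R, 0 < e -> \forall x \near F, `|l - f x| <= e%:C.
Proof.
split=> [/cvgrPdist_le fl e e0 | fl]; first by apply: fl; rewrite ltcR.
apply/cvgrPdist_le => e; rewrite ltcE => /andP[/eqP e_im e_re].
by have -> : e = (complex.Re e)%:C; [case: e e_im {e_re} => a b /= -> | exact: fl].
Qed.

Lemma cvgC_cst (R : realType) T (F : set_system T) (FF : Filter F) (l : R[i]) :
  cvgC F (fun=> l) l.
Proof. exact: cvg_cst. Qed.

Lemma cvgCD (R : realType) T (F : set_system T) (FF : Filter F)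
    (f g : T -> R[i]) (a b : R[i]) :
  cvgC F f a -> cvgC F g b -> cvgC F (fun x => f x + g x) (a + b).
Proof. exact: cvgD. Qed.

Lemma cvgCM (R : realType) T (F : set_system T) (FF : Filter F)
    (f g : T -> R[i]) (a b : R[i]) :
  cvgC F f a -> cvgC F g b -> cvgC F (fun x => f x * g x) (a * b).
Proof. exact: (@cvgM R[i] T F FF f g a b). Qed.

Lemma cvgCX (R : realType) T (F : set_system T) (FF : Filter F)
    (f : T -> R[i]) (a : R[i]) k :
  cvgC F f a -> cvgC F (fun x => f x ^+ k) (a ^+ k).
Proof.
move=> fa; elim: k => [|k IH].
  by rewrite expr0; under eq_fun do rewrite expr0; exact: cvgC_cst.
by rewrite exprS; under eq_fun do rewrite exprS; exact: cvgCM.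
Qed.

Lemma cvgC_sum (R : realType) T (F : set_system T) (FF : Filter F)
    (J : Type) (s : seq J) (f : J -> T -> R[i]) (l : J -> R[i]) :
  (forall j, cvgC F (f j) (l j)) ->
  cvgC F (fun x => \sum_(j <- s) f j x) (\sum_(j <- s) l j).
Proof.
move=> fl; elim: s => [|j s IH].
  rewrite big_nil; under eq_fun do rewrite big_nil; exact: cvgC_cst.
have -> : (fun x => \sum_(i <- j :: s) f i x) =
    (fun x => f j x + \sum_(i <- s) f i x).
  by apply/funext => x; rewrite big_cons.
by rewrite big_cons; exact: cvgCD.
Qed.

(** Exchange of limits: if [V K] approximates [U] uniformly as [K] grows, and each
[V K] converges along [F], then the limit of these limits is the limit of
[U]. *)
Lemma cvgC_interchange (R : realType) T (F : set_system T) (FF : Filter F)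
    (U : T -> R[i]) (V : nat -> T -> R[i]) (W : nat -> R[i]) (S : R[i])
    (tau : nat -> R) :
  (forall K x, `|U x - V K x| <= (tau K)%:C) -> tau @ \oo --> (0 : R) ->
  (forall K, cvgC F (V K) (W K)) -> cvgC \oo W S ->
  cvgC F U S.
Proof.
move=> UV /cvgrPdist_le tau0 VW /cvgCP WS.
apply/cvgCP => e e0; have e3 : 0 < e / 3 by rewrite divr_gt0.
have [K [hW ht]] : exists K, `|S - W K| <= (e / 3)%:C /\ tau K <= e / 3.
  have [K _ hK] := filterI (WS _ e3) (tau0 _ e3); exists K.
  have [/= ? h] := hK K (leqnn K); split=> //.
  by apply: le_trans (ler_norm _) _; rewrite -normrN -sub0r.
have /cvgCP/(_ _ e3) := VW K.
apply: filterS => x hV.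
have -> : S - U x = (S - W K) + ((W K - V K x) - (U x - V K x)) by ring.
have -> : e%:C = (e / 3)%:C + ((e / 3)%:C + (e / 3)%:C).
  by rewrite -!rmorphD; congr (_%:C); field.
apply: le_trans (ler_normD _ _) _; apply: lerD => //.
apply: le_trans (ler_normB _ _) _; apply: lerD => //.
by apply: le_trans (UV _ _) _; rewrite lecR.
Qed.

(** The limit is built from its real and imaginary parts, by completeness of
[R]. *)
Lemma seriesC_dominated (R : realType) (u : nat -> R[i]) (v : nat -> R) :
  (forall n, `|u n| <= (v n)%:C) -> cvgn (series v) ->
  exists S : R[i], cvgC \oo (seriesC u) S.
Proof.
move=> uv cv.
have part (f : {additive Rcomplex R -> R}) :
    (forall z : R[i], `|f z|%:C <= `|z|) ->
    exists a, forall e : R, 0 < e -> \forall n \near \oo, `|a - f (seriesC u n)| <= e.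
  move=> fle; have fv n : `|f (u n)| <= v n.
    by rewrite -lecR; apply: le_trans (fle _) (uv n).
  have : cvgn (series (fun n => f (u n) : R^o)).
    apply: (@normed_cvg R R^o); apply: series_le_cvg cv => n //=.
    by apply: le_trans (fv n).
  move=> /cvg_ex[a /cvgrPdist_le ha]; exists a => e /ha.
  by apply: filterS => n; rewrite /series /= /seriesC [f _]raddf_sum.
have [a ha] := part _ (@normc_ge_Re R).
have [b hb] := part _ (@normc_ge_Im R).
exists (a +i* b); apply/cvgCP => e e0.
have e2 : 0 < e / 2 by rewrite divr_gt0.
apply: filterS2 (ha _ e2) (hb _ e2) => n hn1 hn2.
apply: le_trans (normc_le_ReIm _) _; rewrite lecR [e]splitr.
by move: hn1 hn2; case: (seriesC u n) => x y /=; exact: lerD.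
Qed.

(** The coefficients are bounded, by convergence at [1].  If [c k] is the first
nonzero one, the remaining terms of the series at a small [t > 0] add up to at
most [2 M t ^ (k + 1)], which is too small to cancel [c k * t ^ k]. *)
Lemma power_series_eq0 (R : realType) (c : nat -> R[i]) :
  (forall t : R[i], cvgC \oo (seriesC (fun n => c n * t ^+ n)) 0) ->
  forall n, c n = 0.
Proof.
move=> c0.
have [M M0 cM] : exists2 M : R, 0 < M & forall n, `|c n| <= M%:C.
  have /cvgP/cvg_series_cvg_0/cvgCP/(_ 1 ltr01)[N _ hN] := c0 1.
  have nE n : (complex.Re `|c n|)%:C = `|c n| by exact: RRe_real (normr_real _).
  have n0 n : 0 <= complex.Re `|c n| by rewrite -ler0c nE.
  have s0 (P : pred 'I_N) : 0 <= \sum_(n < N | P n) complex.Re `|c n|.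
    by apply: sumr_ge0 => n _.
  exists (1 + \sum_(n < N) complex.Re `|c n|) => [|n]; first by rewrite ltr_wpDr.
  rewrite rmorphD; have [Nn|nN] := leqP N n.
    apply: ler_wpDr; first by rewrite ler0c.
    by have := hN n Nn; rewrite /= sub0r normrN expr1n mulr1.
  apply: ler_wpDl; first by rewrite ler0c.
  by rewrite -nE lecR (bigD1 (Ordinal nN))//= lerDl.
move=> n; elim/ltn_ind: n => k IH.
apply/eqP/negPn/negP => ck0.
pose a := complex.Re `|c k|.
have aE : `|c k| = a%:C by rewrite [RHS]RRe_real ?normr_real.
have a0 : 0 < a by have : 0 < `|c k| by [rewrite normr_gt0]; rewrite aE (ltcR 0).
have aM : a <= M by rewrite -lecR -aE.
(* With this t the tail is at most half of the leading term. *)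
pose t := a / (4 * M).
have t0 : 0 < t by rewrite divr_gt0// mulr_gt0.
have t2 : t <= 2^-1.
  rewrite ler_pdivrMr ?mulr_gt0//; lra.
have tE : 2 * M * t = a / 2 by rewrite /t; field; rewrite gt_eqF.
clearbody t.
(* The term - 2 M t ^ N makes the induction on N go through. *)
have tail N : (k < N)%N ->
    `|\sum_(k.+1 <= n < N) c n * t%:C ^+ n| <= (2 * M * t ^+ k.+1 - 2 * M * t ^+ N)%:C.
  elim: N => // N IHN; rewrite ltnS leq_eqVlt => /predU1P[<-|kN].
    by rewrite big_geq// normr0 subrr.
  rewrite big_nat_recr//=; apply: le_trans (ler_normD _ _) _.
  apply: le_trans (lerD (IHN kN) (_ : _ <= (M * t ^+ N)%:C)) _.
    rewrite normrM normrX [ `|t%:C|]ger0_norm ?ler0c ?(ltW t0)// rmorphM rmorphXn.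
    by rewrite ler_wpM2r// exprn_ge0// ler0c ltW.
  rewrite -rmorphD lecR [t ^+ N.+1]exprS.
  suff : 2 * M * (t * t ^+ N) <= M * t ^+ N by lra.
  have : 0 <= M * t ^+ N by rewrite mulr_ge0 ?exprn_ge0// ltW.
  nra.
have e0 : 0 < a * t ^+ k / 4 by rewrite divr_gt0// mulr_gt0// exprn_gt0.
have /cvgCP/(_ _ e0)[N _ hN] := c0 t%:C.
have /= := hN (maxn N k.+1) (leq_maxl _ _).
have kN := leq_maxr N k.+1; move: (maxn _ _) kN => {hN}N kN.
rewrite sub0r normrN /seriesC (big_cat_nat _ (n := k))//=; last exact: ltnW.
rewrite big_nat big1 => [|i /andP[_ ik]]; last by rewrite IH// mul0r.
rewrite add0r big_ltn//; set T := \sum_(_ <= _ < _) _ => hle.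
have hT : `|T| <= (a * t ^+ k / 2)%:C.
  apply: le_trans (tail N kN) _; rewrite lecR exprS.
  rewrite mulrA tE mulrAC.
  by rewrite gerBl mulr_ge0 ?exprn_ge0 ?mulr_ge0// ltW.
have : `|c k * t%:C ^+ k| <= (a * t ^+ k / 4 + a * t ^+ k / 2)%:C.
  rewrite -[c k * _](addrK T) rmorphD.
  by apply: le_trans (ler_normB _ _) _; exact: lerD.
rewrite normrM normrX aE [ `|t%:C|]ger0_norm ?ler0c ?(ltW t0)//.
rewrite -rmorphXn -rmorphM lecR.
by have : 0 < a * t ^+ k; [rewrite mulr_gt0 ?exprn_gt0 | lra].
Qed.

(** * Multiple geometric series *)

(** Distributivity: the sum of [X ^ (j_1 + ... + j_r)] factors into [r] equal
sums. *)
Lemma sum_ffun_expr (K : comNzRingType) (X : K) (r N : nat) :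
  \sum_(j : {ffun 'I_r -> 'I_N}) X ^+ (\sum_(l < r) j l)%N =
  (\sum_(i < N) X ^+ i) ^+ r.
Proof.
rewrite -[in RHS](card_ord r) -prodr_const bigA_distr_bigA /=.
by apply: eq_bigr => j _; rewrite expr_sum.
Qed.

Definition nat_ffun r N (j : {ffun 'I_r -> 'I_N}) : {ffun 'I_r -> nat} :=
  [ffun l => nat_of_ord (j l)].

Definition box r N : {fset {ffun 'I_r -> nat}} :=
  [fset nat_ffun j | j in enum {: {ffun 'I_r -> 'I_N}}]%fset.

Lemma sum_box (K : comNzRingType) (X : K) (r N : nat) :
  \sum_(m <- box r N) X ^+ (\sum_(l < r) m l)%N = (\sum_(i < N) X ^+ i) ^+ r.
Proof.
rewrite big_imfset /=; last first.
  move=> j j' _ _ /ffunP e; apply/ffunP => l; apply: val_inj.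
  by have := e l; rewrite !ffunE.
rewrite -sum_ffun_expr undup_id ?enum_uniq// big_enum /=; apply: eq_bigr => j _.
by congr (X ^+ _); apply: eq_bigr => l _; rewrite ffunE.
Qed.

(** Cofinality of the boxes [{0, ..., N - 1} ^ r] among the finite sets of indices
reduces the unconditional sum to a limit of box sums. *)
Lemma sub_box r (A : {fset {ffun 'I_r -> nat}}) :
  exists N, (A `<=` box r N)%fset.
Proof.
exists (\max_(m <- A) \max_l m l).+1; apply/fsubsetP => m mA.
have lt l : (m l < (\max_(m <- A) \max_l m l).+1)%N.
  rewrite ltnS; apply: leq_trans (leq_bigmax l) _.
  by apply: (@leq_bigmax_seq _ (enum_fset A) xpredT
    (fun m : {ffun 'I_r -> nat} => \max_l m l) m).
apply/imfsetP; exists [ffun l => Ordinal (lt l)]; first by rewrite /= mem_enum.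
by apply/ffunP => l; rewrite !ffunE.
Qed.

Lemma sum_fset_incl (R : numDomainType) (I : choiceType) (A B : {fset I})
    (f : I -> R) :
  (forall i, 0 <= f i) -> (A `<=` B)%fset ->
  \sum_(i <- A) f i <= \sum_(i <- B) f i.
Proof.
move=> f0 AB; rewrite [leRHS](big_fsetID _ (mem A)) /=.
have -> : [fset x in B | x \in A]%fset = A.
  by apply/fsetP => x; rewrite !inE /= andbC; apply: andb_idr => /(fsubsetP AB).
by rewrite lerDl sumr_ge0.
Qed.

Lemma geometric_sum (F : fieldType) (X : F) N : X != 1 ->
  \sum_(i < N) X ^+ i = (1 - X ^+ N) / (1 - X).
Proof.
move=> X1; rewrite -[1 - _]opprB subrX1 -mulNr opprB mulrC mulKf//.
by rewrite subr_eq0 eq_sym.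
Qed.

Lemma sum_multi_geometric_le (R : numFieldType) (p : R) (r : nat)
    (A : {fset {ffun 'I_r -> nat}}) :
  0 <= p < 1 ->
  \sum_(m <- A) p ^+ (\sum_(l < r) m l)%N <= (1 - p)^-1 ^+ r.
Proof.
move=> /andP[p0 p1]; have [N AN] := sub_box A.
apply: le_trans (sum_fset_incl _ AN) _; first by move=> m; exact: exprn_ge0.
have p1' : 0 < 1 - p by rewrite subr_gt0.
rewrite sum_box lerXn2r ?nnegrE ?invr_ge0 ?(ltW p1')//.
  by apply: sumr_ge0 => i _; exact: exprn_ge0.
by rewrite geometric_sum ?lt_eqF// ler_pdivrMr// mulVf ?gt_eqF// gerBl exprn_ge0.
Qed.

Lemma cvgC_expr0 (R : realType) (X : R[i]) : `|X| < 1 ->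
  cvgC \oo (fun N => X ^+ N) 0.
Proof.
have XE : (complex.Re `|X|)%:C = `|X| by exact: RRe_real (normr_real _).
rewrite -XE (ltcR _ 1) => X1; have X0 : 0 <= complex.Re `|X| by rewrite -ler0c XE.
have /cvg_expr/cvgrPdist_le h : `|complex.Re `|X| | < 1 by rewrite ger0_norm.
apply/cvgCP => e /h; apply: filterS => n; rewrite !sub0r !normrN normrX.
by rewrite (ger0_norm X0) => hn; rewrite normrX -XE -rmorphXn lecR.
Qed.

Lemma cvgC_sum_box (R : realType) (X : R[i]) (r : nat) : `|X| < 1 ->
  cvgC \oo (fun N => \sum_(m <- box r N) X ^+ (\sum_(l < r) m l)%N)
    ((1 - X)^-1 ^+ r).
Proof.
move=> X1; have X1' : X != 1 by apply: contraTneq X1 => ->; rewrite normr1 ltxx.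
have -> : (fun N => \sum_(m <- box r N) X ^+ (\sum_(l < r) m l)%N) =
    (fun N => ((1 + -1 * X ^+ N) * (1 - X)^-1) ^+ r).
  by apply/funext => N; rewrite sum_box geometric_sum// mulN1r.
apply: cvgCX; rewrite -[X in cvgC _ _ X]mul1r -[X in cvgC _ _ (X * _)]addr0.
rewrite -[X in cvgC _ _ ((_ + X) * _)](mulr0 (-1)).
apply: cvgCM; last exact: cvgC_cst.
apply: cvgCD; first exact: cvgC_cst.
by apply: cvgCM; [exact: cvgC_cst | exact: cvgC_expr0].
Qed.

(** Box sums are [r]-th powers of geometric sums.  Beyond a large box, the sum over
any finite set is at most the tail of the same series for [`|X|], which is
small. *)
Lemma cvgC_multi_geometric (R : realType) (X : R[i]) (r : nat) : `|X| < 1 ->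
  cvgC (@totally _) (fun A : {fset {ffun 'I_r -> nat}} =>
     \sum_(m <- A) X ^+ (\sum_(l < r) m l)%N) ((1 - X)^-1 ^+ r).
Proof.
move=> X1; set p : R[i] := `|X|.
have p01 : 0 <= p < 1 by rewrite normr_ge0.
have p1 : `|p| < 1 by rewrite normr_id.
have /cvgCP hX := @cvgC_sum_box R X r X1.
have /cvgCP hp := @cvgC_sum_box R p r p1.
apply/(cvgCP totally_filter) => e e0.
have e2 : 0 < e / 2 by rewrite divr_gt0.
have [N _ hN] := filterI (hX _ e2) (hp _ e2).
have [/= hXN hpN] := hN N (leqnn N).
exists (box r N) => //= A sNA.
have split (Y : R[i]) : \sum_(m <- A) Y ^+ (\sum_(l < r) m l)%N =
    \sum_(m <- box r N) Y ^+ (\sum_(l < r) m l)%N +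
    \sum_(m <- [fset x in A | x \notin box r N]%fset) Y ^+ (\sum_(l < r) m l)%N.
  rewrite (big_fsetID _ (mem (box r N))) /=; congr (_ + _).
  congr (\sum_(m <- _) _); congr enum_fset.
  by apply/fsetP => x; rewrite !inE /= andbC; apply: andb_idr => /(fsubsetP sNA).
rewrite split opprD addrA.
have -> : e%:C = (e / 2)%:C + (e / 2)%:C by rewrite -rmorphD -splitr.
apply: le_trans (ler_normB _ _) _; apply: lerD => //.
apply: le_trans (ler_norm_sum _ _ _) _.
under eq_bigr do rewrite normrX -/p.
have := sum_multi_geometric_le A p01; rewrite split -lerBrDl => hle.
apply: (le_trans hle); apply: le_trans hpN.
rewrite -[leLHS]ger0_norm//; apply: le_trans hle.
by apply: sumr_ge0 => m _; apply: exprn_ge0; exact: normr_ge0.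
Qed.

(** * The generating function in closed form *)

#[local] Existing Instance totally_filter.

(** [E_n / (1 + Q) ^ r], where [Q] stands for [q ^ c] and [w] for [q ^ (c y)]. *)
Definition qEuler_coef (R : realType) (Q w : R[i]) (r n : nat) : R[i] :=
  (1 - Q)^-1 ^+ n *
  \sum_(k < n.+1) 'C(n, k)%:R * (- w) ^+ k * (1 + Q ^+ k.+1)^-1 ^+ r.

(** Geometric growth of the coefficients, whence convergence everywhere of their
exponential generating series; [`|1 + Q ^ (k + 1)|] is at least [1 - `|Q|]. *)
Lemma norm_qEuler_coef (R : realType) (Q w : R[i]) (r n : nat) : `|Q| < 1 ->
  `|qEuler_coef Q w r n| <=
    (`|(1 - Q)^-1| * (1 + `|w|)) ^+ n * (1 - `|Q|)^-1 ^+ r.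
Proof.
move=> Q1; have Q1' : 0 < 1 - `|Q| by rewrite subr_gt0.
rewrite /qEuler_coef normrM normrX exprMn -mulrA ler_wpM2l ?exprn_ge0//.
apply: le_trans (ler_norm_sum _ _ _) _.
rewrite exprDn mulr_suml; apply: ler_sum => k _.
rewrite !normrM normr_nat normrX normrN expr1n mul1r.
rewrite -[ `|w| ^+ k *+ _]mulr_natl ler_wpM2l//.
rewrite normrX lerXn2r ?nnegrE ?invr_ge0 ?(ltW Q1')//.
have le1 : 1 - `|Q| <= `|1 + Q ^+ k.+1|.
  apply: le_trans (lerB_normD _ _); rewrite normr1 lerD2l lerN2 normrX exprS.
  by rewrite ler_piMr// exprn_ile1// ltW.
by rewrite normfV lef_pV2// posrE (lt_le_trans Q1').
Qed.

(** The binomial theorem applied to [(1 - w Q ^ s) ^ n] turns the truncated series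
into a combination of multiple geometric sums of ratio [- Q ^ (k + 1)]. *)
Lemma sum_taylor_qexp (R : realType) (Q w t : R[i]) (r K : nat)
    (A : {fset {ffun 'I_r -> nat}}) :
  \sum_(m <- A) (- Q) ^+ (\sum_(l < r) m l)%N *
    \sum_(n < K) ((1 - w * Q ^+ (\sum_(l < r) m l)%N) / (1 - Q) * t) ^+ n / n`!%:R =
  \sum_(0 <= n < K) (((1 - Q)^-1 * t) ^+ n / n`!%:R *
    \sum_(k < n.+1) 'C(n, k)%:R * (- w) ^+ k *
      \sum_(m <- A) (- Q ^+ k.+1) ^+ (\sum_(l < r) m l)%N).
Proof.
under eq_bigr do rewrite mulr_sumr.
rewrite exchange_big big_mkord /=; apply: eq_bigr => n _.
under [in RHS]eq_bigr do rewrite mulr_sumr.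
rewrite exchange_big /= mulr_sumr; apply: eq_bigr => m _.
set s := (\sum_(l < r) m l)%N.
rewrite -[_ / _ * t]mulrA exprMn exprDn !mulr_suml !mulr_sumr.
apply: eq_bigr => k _.
rewrite expr1n mul1r -mulNr exprMn -[_ *+ _]mulr_natl.
have -> : (- Q ^+ k.+1) ^+ s = (- Q) ^+ s * (Q ^+ s) ^+ k.
  by rewrite exprS -mulNr exprMn -!exprM mulnC.
ring.
Qed.

(** The generating function: both sides have the same sum, since the exponential
may be expanded under the multiple series. *)
Lemma qexp_series (R : realType) (Q w t : R[i]) (r : nat) : `|Q| < 1 ->
  exists2 S : R[i],
    cvgC (@totally _) (fun A : {fset {ffun 'I_r -> nat}} =>
      \sum_(m <- A) (- Q) ^+ (\sum_(l < r) m l)%N *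
        cexp ((1 - w * Q ^+ (\sum_(l < r) m l)%N) / (1 - Q) * t)) S &
    cvgC \oo (seriesC (fun n => qEuler_coef Q w r n * t ^+ n / n`!%:R)) S.
Proof.
move=> Q1.
have absC (z : R[i]) : exists2 a : R, 0 <= a & a%:C = `|z|.
  have E : (complex.Re `|z|)%:C = `|z| by exact: RRe_real (normr_real _).
  by exists (complex.Re `|z|); rewrite // -ler0c E.
have [p p0 pE] := absC Q.
have [d d0 dE] := absC ((1 - Q)^-1 * t).
have [v v0 vE] := absC w.
pose rho := d * (1 + v); pose C0 := (1 - p)^-1 ^+ r.
have p1 : p < 1 by rewrite -(ltcR p 1) pE.
have C0E : C0%:C = (1 - `|Q|)^-1 ^+ r.
  by rewrite /C0 rmorphXn fmorphV rmorphB /= pE.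
have C00 : 0 <= C0 by rewrite exprn_ge0// invr_ge0 subr_ge0 ltW.
have rhoE : rho%:C = `|(1 - Q)^-1 * t| * (1 + `|w|).
  by rewrite /rho rmorphM rmorphD /= dE vE.
have rho0 : 0 <= rho by rewrite mulr_ge0 ?addr_ge0.
clearbody rho C0.
have [S hS] : exists S : R[i],
    cvgC \oo (seriesC (fun n => qEuler_coef Q w r n * t ^+ n / n`!%:R)) S.
  apply: (@seriesC_dominated _ _ (C0 *: exp_coeff rho)).
    move=> n; change ((C0 *: exp_coeff rho) n) with (C0 * (rho ^+ n / n`!%:R)).
    rewrite 2!normrM normfV normr_nat normrX.
    apply: (@le_trans _ _ ((`|(1 - Q)^-1| * (1 + `|w|)) ^+ n *
      (1 - `|Q|)^-1 ^+ r * `|t| ^+ n / n`!%:R)).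
      rewrite ler_wpM2r ?invr_ge0//; rewrite ler_wpM2r ?exprn_ge0//.
      exact: norm_qEuler_coef.
    rewrite rmorphM rmorphM rmorphXn fmorphV rmorph_nat /= C0E rhoE normrM !exprMn.
    by rewrite le_eqVlt; apply/orP; left; apply/eqP; ring.
  apply: is_cvg_seriesZ; exact: is_cvg_series_exp_coeff.
exists S => //.
pose tau K := C0 * (2 * expR rho * ((2 * rho) ^+ K / K`!%:R)).
pose V K (A : {fset {ffun 'I_r -> nat}}) :=
  \sum_(0 <= n < K) (((1 - Q)^-1 * t) ^+ n / n`!%:R *
    \sum_(k < n.+1) 'C(n, k)%:R * (- w) ^+ k *
      \sum_(m <- A) (- Q ^+ k.+1) ^+ (\sum_(l < r) m l)%N).
apply: (@cvgC_interchange R _ totally totally_filter _ V _ S tau _ _ _ hS).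
- move=> K A; rewrite /V -sum_taylor_qexp -sumrB.
  apply: le_trans (ler_norm_sum _ _ _) _.
  rewrite /tau rmorphM /= C0E.
  apply: (@le_trans _ _ (\sum_(m <- A) `|Q| ^+ (\sum_(l < r) m l)%N *
      (2 * expR rho * ((2 * rho) ^+ K / K`!%:R))%:C)).
    apply: ler_sum => m _; rewrite -mulrBr normrM normrX normrN.
    rewrite ler_wpM2l ?exprn_ge0//; apply: norm_cexp_taylor.
    set s := (\sum_(l < r) m l)%N.
    rewrite rhoE -mulrA normrM mulrC ler_wpM2l//.
    apply: le_trans (ler_normB _ _) _; rewrite normr1 lerD2l normrM normrX.
    by rewrite ler_piMr// exprn_ile1// ltW.
  rewrite -mulr_suml ler_wpM2r//.
    by rewrite ler0c !mulr_ge0 ?expR_ge0 ?exprn_ge0 ?invr_ge0 ?mulr_ge0.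
  by apply: sum_multi_geometric_le; rewrite normr_ge0 Q1.
- have -> : tau = (C0 * (2 * expR rho)) *: exp_coeff (2 * rho).
    by apply/funext => K; exact: mulrA.
  by rewrite -[0](mulr0 (C0 * (2 * expR rho))); apply: cvgZl_tmp; exact: cvg_exp_coeff.
- move=> K; rewrite /V /seriesC; apply: cvgC_sum => n.
  rewrite /qEuler_coef.
  have -> : forall G, (1 - Q)^-1 ^+ n * G * t ^+ n / n`!%:R =
      ((1 - Q)^-1 * t) ^+ n / n`!%:R * G.
    by move=> G; rewrite exprMn; ring.
  apply: cvgCM; first exact: cvgC_cst.
  apply: cvgC_sum => k; apply: cvgCM; first exact: cvgC_cst.
  rewrite -[X in (1 + X)^-1]opprK; apply: cvgC_multi_geometric.
  by rewrite normrN normrX exprn_ilt1// ltW.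
Qed.

Lemma qpowD (R : realType) (L : R[i]) (y z : R) :
  qpow L (y + z) = qpow L y * qpow L z.
Proof. by rewrite /qpow rmorphD mulrDl cexpD. Qed.

Lemma qpowMn (R : realType) (L : R[i]) (n : nat) (y : R) :
  qpow L (n%:R * y) = qpow L y ^+ n.
Proof. by rewrite /qpow rmorphM rmorph_nat -mulrA cexpMn. Qed.

Lemma qpow_nat (R : realType) (L : R[i]) (n : nat) :
  qpow L n%:R = cexp L ^+ n.
Proof. by rewrite /qpow rmorph_nat cexpMn. Qed.

Lemma qnumE (R : realType) (L : R[i]) (c s : nat) (y : R) :
  qnum L c (s%:R + y) =
    (1 - qpow L (c%:R * y) * (cexp L ^+ c) ^+ s) / (1 - cexp L ^+ c).
Proof. by rewrite /qnum mulrDr qpowD -natrM qpow_nat exprM [_ * qpow _ _]mulrC. Qed.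

Lemma qnum2 (R : realType) (L : R[i]) (c : nat) :
  cexp L ^+ c != 1 -> qnum L c 2 = 1 + cexp L ^+ c.
Proof.
move=> Q1; rewrite /qnum -natrM qpow_nat exprM; field.
by rewrite subr_eq0 eq_sym.
Qed.

Lemma is_qEuler_coef (R : realType) (L : R[i]) (c r : nat) (y : R) :
  `|cexp L ^+ c| < 1 ->
  is_qEuler L c r y (fun n => (1 + cexp L ^+ c) ^+ r *
    qEuler_coef (cexp L ^+ c) (qpow L (c%:R * y)) r n).
Proof.
set Q := cexp L ^+ c => Q1 t.
have Q1' : Q != 1 by apply: contraTneq Q1 => ->; rewrite normr1 ltxx.
have [S h1 h2] := @qexp_series R Q (qpow L (c%:R * y)) t r Q1.
exists S.
  have -> // : partial_sum (@qEuler_term R L c r y t) =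
    (fun A : {fset {ffun 'I_r -> nat}} =>
      \sum_(m <- A) (- Q) ^+ (\sum_(l < r) m l)%N *
        cexp ((1 - qpow L (c%:R * y) * Q ^+ (\sum_(l < r) m l)%N) / (1 - Q) * t)).
  apply/funext => A; rewrite /partial_sum.
  rewrite -(big_seq_fsetE _ A xpredT (@qEuler_term R L c r y t)) /=.
  apply: eq_bigr => m _; rewrite /qEuler_term qnumE -/Q.
  by rewrite exprM -exprMn mulN1r.
have := @cvgCM R nat \oo _ _ _ _ S (@cvgC_cst R nat \oo _ ((1 + Q) ^+ r)) h2.
rewrite (qnum2 Q1').
suff E : series (fun n => (1 + Q) ^+ r *
    qEuler_coef Q (qpow L (c%:R * y)) r n * t ^+ n / n`!%:R : R[i]^o) =
  (fun N => (1 + Q) ^+ r * seriesC (fun n =>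
     qEuler_coef Q (qpow L (c%:R * y)) r n * t ^+ n / n`!%:R) N).
  by move=> h; rewrite /cvgC in h; rewrite E; exact: h.
apply/funext => N; rewrite /series /seriesC mulr_sumr /=.
by apply: eq_bigr => n _; rewrite !mulrA.
Qed.

(** The sum [S] of the multiple series does not depend on the coefficients, so the
difference of two solutions generates a power series with sum [0]. *)
Lemma is_qEuler_unique (R : realType) (L : R[i]) (c r : nat) (y : R)
    (E E' : nat -> R[i]) :
  is_qEuler L c r y E -> is_qEuler L c r y E' -> E = E'.
Proof.
move=> hE hE'; apply/funext => n; apply/eqP; rewrite -subr_eq0; apply/eqP.
suff /(_ n)/eqP : forall n, (E n - E' n) / n`!%:R = 0.
  by rewrite mulf_eq0 invr_eq0 pnatr_eq0 -leqn0 leqNgt fact_gt0 orbF => /eqP.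
move=> {n}; apply: power_series_eq0 => t.
have [S hS h] := hE t; have [S' hS' h'] := hE' t.
have SS' : S = S'.
  exact: (@cvg_unique _ (@norm_hausdorff _ R[i]^o) _ _ _ _ hS hS').
rewrite -{}SS' in h'.
pose V (E : nat -> R[i]) := seriesC (fun n => E n * t ^+ n / n`!%:R).
pose l : R[i] := qnum L c 2 ^+ r * S.
have hV : cvgC \oo (V E) l by exact: h.
have hV' : cvgC \oo (V E') l by exact: h'.
have h0 : cvgC \oo (fun N => V E N + -1 * V E' N) (l + -1 * l).
  exact: (cvgCD _ hV (cvgCM _ (@cvgC_cst R nat \oo _ (-1)) hV')).
have l0 : l + -1 * l = 0 by rewrite mulN1r subrr.
rewrite l0 in h0.
have E0 : seriesC (fun n => (E n - E' n) / n`!%:R * t ^+ n) =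
    (fun N => V E N + -1 * V E' N).
  apply/funext => N; rewrite /V /seriesC mulN1r -sumrB.
  by apply: eq_bigr => k _; ring.
by rewrite E0.
Qed.

Lemma qEulerE (R : realType) (L : R[i]) (c r n : nat) (y : R) :
  `|cexp L ^+ c| < 1 ->
  qEuler L c r n y = (1 + cexp L ^+ c) ^+ r *
    qEuler_coef (cexp L ^+ c) (qpow L (c%:R * y)) r n.
Proof.
move=> Q1; have h := is_qEuler_coef r y Q1.
have := xgetPex (fun=> 0) (ex_intro (fun E => is_qEuler L c r y E) _ h).
by rewrite /qEuler => h'; rewrite (is_qEuler_unique h' h).
Qed.

(** * The symmetry *)

(** The right-hand side is symmetric in [a] and [b].  For each [k], the sum over
[j] is the [r]-th power of the geometric sum of ratio [X = - q ^ (b (k + 1))],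
and [X ^ a = - q ^ (a b (k + 1))] because [a] is odd. *)
Lemma qEuler_coef_sum (R : realType) (q W : R[i]) (r n a b : nat) :
  `|q| < 1 -> (0 < a)%N -> (0 < b)%N -> odd a ->
  ((1 - q ^+ a) / (1 - q)) ^+ n *
    (\sum_(j : {ffun 'I_r -> 'I_a})
       (-1) ^+ (\sum_(l < r) j l)%N * q ^+ (b * \sum_(l < r) j l)%N *
       qEuler_coef (q ^+ a) (W * (q ^+ b) ^+ (\sum_(l < r) j l)%N) r n) =
  (1 - q)^-1 ^+ n * \sum_(k < n.+1) 'C(n, k)%:R * (- W) ^+ k *
    ((1 + q ^+ (a * b * k.+1)) /
      ((1 + q ^+ (a * k.+1)) * (1 + q ^+ (b * k.+1)))) ^+ r.
Proof.
move=> q1 a0 b0 odda.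
have lt1 m : (0 < m)%N -> `|q ^+ m| < 1.
  by move=> m0; rewrite normrX exprn_ilt1// -lt0n.
have neq1 (z : R[i]) : `|z| < 1 -> z != 1.
  by apply: contraTneq => ->; rewrite normr1 ltxx.
have qa1 : q ^+ a != 1 by exact: neq1 (lt1 _ a0).
under eq_bigr => j _ do rewrite mulrCA.
rewrite -mulr_sumr mulrA -exprMn.
have -> : (1 - q ^+ a) / (1 - q) / (1 - q ^+ a) = (1 - q)^-1.
  by rewrite mulrAC divff ?mul1r// subr_eq0 eq_sym.
congr (_ * _); under eq_bigr do rewrite mulr_sumr.
rewrite exchange_big /=; apply: eq_bigr => k _.
set X := - q ^+ (b * k.+1).
have X1 : X != 1 by apply: neq1; rewrite normrN lt1// muln_gt0 b0.
transitivity ('C(n, k)%:R * (- W) ^+ k * (1 + (q ^+ a) ^+ k.+1)^-1 ^+ r *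
    (\sum_(i < a) X ^+ i) ^+ r).
  rewrite -sum_ffun_expr mulr_sumr; apply: eq_bigr => j _.
  set s := (\sum_(l < r) j l)%N.
  have -> : X ^+ s = (-1) ^+ s * q ^+ (b * s) * ((q ^+ b) ^+ s) ^+ k.
    by rewrite /X -[- q ^+ _]mulN1r exprMn -!exprM -mulrA -exprD mulnA -mulnS mulnAC.
  by rewrite -mulNr exprMn; ring.
rewrite geometric_sum// -mulrA -exprMn; congr (_ * _ ^+ r).
have -> : X ^+ a = - q ^+ (a * b * k.+1).
  by rewrite /X exprNn -signr_odd odda expr1 mulN1r -exprM mulnC mulnA.
by rewrite /X !opprK -exprM invfM mulrCA.
Qed.

Theorem theorem2 (R : realType) (q L : R[i]) (r : nat) (x : R) (n a b : nat)
    (hq : 0 < `|q| < 1) (hL : cexp L = q) (hr : (1 <= r)%N)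
    (ha : (1 <= a)%N) (hb : (1 <= b)%N)
    (ha2 : a = 1 %[mod 2]) (hb2 : b = 1 %[mod 2]) :
  qnum L b 2 ^+ r * qnum L 1 a%:R ^+ n *
    (\sum_(j : {ffun 'I_r -> 'I_a})
       (-1) ^+ (\sum_(l < r) j l)%N * q ^+ (b * \sum_(l < r) j l)%N *
       qEuler L a r n
         (b%:R * x + b%:R / a%:R * (\sum_(l < r) j l)%N%:R))
  =
  qnum L a 2 ^+ r * qnum L 1 b%:R ^+ n *
    (\sum_(j : {ffun 'I_r -> 'I_b})
       (-1) ^+ (\sum_(l < r) j l)%N * q ^+ (a * \sum_(l < r) j l)%N *
       qEuler L b r n
         (a%:R * x + a%:R / b%:R * (\sum_(l < r) j l)%N%:R)).
Proof.
have [_ q1] := andP hq; subst q.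
have Q1 c : (0 < c)%N -> `|cexp L ^+ c| < 1.
  by move=> c0; rewrite normrX exprn_ilt1// -lt0n.
have Q1' c : (0 < c)%N -> cexp L ^+ c != 1.
  by move=> /Q1; apply: contraTneq => ->; rewrite normr1 ltxx.
suff side c d : (0 < c)%N -> (0 < d)%N -> odd c ->
  qnum L d 2 ^+ r * qnum L 1 c%:R ^+ n *
    (\sum_(j : {ffun 'I_r -> 'I_c})
       (-1) ^+ (\sum_(l < r) j l)%N * cexp L ^+ (d * \sum_(l < r) j l)%N *
       qEuler L c r n (d%:R * x + d%:R / c%:R * (\sum_(l < r) j l)%N%:R)) =
  ((1 + cexp L ^+ c) * (1 + cexp L ^+ d)) ^+ r * ((1 - cexp L)^-1 ^+ n *
    \sum_(k < n.+1) 'C(n, k)%:R * (- qpow L ((c * d)%:R * x)) ^+ k *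
    ((1 + cexp L ^+ (c * d * k.+1)) /
      ((1 + cexp L ^+ (c * k.+1)) * (1 + cexp L ^+ (d * k.+1)))) ^+ r).
  have odd_of m : m = 1 %[mod 2] -> odd m by rewrite !modn2; case: odd.
  rewrite !side ?odd_of// [(1 + cexp L ^+ a) * _]mulrC.
  congr (_ * (_ * _)); rewrite (mulnC a b); apply: eq_bigr => k _.
  by rewrite [(1 + cexp L ^+ (a * _)) * _]mulrC.
move=> c0 d0 oddc.
rewrite -(@qEuler_coef_sum R (cexp L) _ r n c d) ?Q1//.
rewrite qnum2 ?Q1'// /qnum mul1r qpow_nat expr1.
have -> : forall P1 P2 B1 S1 : R[i],
    (P1 * P2) ^+ r * (B1 * S1) = P2 ^+ r * B1 * (P1 ^+ r * S1).
  by move=> P1 P2 B1 S1; rewrite exprMn; ring.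
congr (_ * _); rewrite mulr_sumr; apply: eq_bigr => j _.
set s := (\sum_(l < r) j l)%N.
rewrite qEulerE ?Q1// [RHS]mulrCA; congr (_ * (_ * qEuler_coef _ _ _ _)).
have c0' : c%:R != 0 :> R by rewrite pnatr_eq0 -lt0n.
have -> : c%:R * (d%:R * x + d%:R / c%:R * s%:R) = (c * d)%:R * x + s%:R * d%:R.
  by rewrite natrM; field.
by rewrite qpowD [qpow L (s%:R * _)]qpowMn qpow_nat.
Qed.
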